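(* Let $m\ge1$, $k\ge1$ be integers, $\underline\lambda=(\lambda_1,\dots,\lambda_m)\in\mathbb{R}^m$, $\mu\in\mathbb{R}$, $\delta=\mu-\sum_j\lambda_j$, with $\delta\notin\{1,\tfrac32,\dots,k\}$. There exists a principal symbol (i.e. a choice of non-singular matrices $[\beta]_0,\dots,[\beta]_k$) for which the corresponding $\mathfrak{sl}(2)$-equivariant quantization map $Q^\beta_{\underline\lambda,\mu}:\bigoplus_{j=0}^k\mathcal{S}^{(j)}_{\delta-j}\to\mathcal{D}^k_{\underline\lambda;\mu}$ is $\mathrm{Vect}(M)$-equivariant only in the following cases: 1. $k=1$; 2. $k=2$ and $\underline\lambda=\underline 0$ or $\underline\lambda=(1-\delta)\mathbf 1_j$ for some $j\in\{1,\dots,m\}$. (In these cases such a principal symbol exists, and in no other case does it exist.)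
   Context: $M$ is $\mathbb{R}$ or $S^1$ (for $S^1$, identified with the projective line, $x$ is an affine coordinate). For $\lambda\in\mathbb{R}$, $\mathcal{F}_\lambda$ is the space of smooth $\lambda$-densities $a\,(dx)^\lambda$ on $M$, with the $\mathrm{Vect}(M)$-action $L_X^\lambda(a\,(dx)^\lambda)=(Xa'+\lambda X'a)(dx)^\lambda$ for $X=X(x)\partial_x$. Multi-indices $\underline i=(i_1,\dots,i_m)$ have non-negative integer entries, $|\underline i|=\sum_j i_j$, and $\mathbf 1_j$ is the tuple with $1$ in position $j$ and $0$ elsewhere. $\mathcal{D}^k_{\underline\lambda;\mu}$ is the space of $m$-ary differential operators of order $\le k$, $A=\sum_{|\underline i|\le k}a_{\underline i}\,\partial_{\underline i}:\mathcal{F}_{\lambda_1}\otimes\cdots\otimes\mathcal{F}_{\lambda_m}\to\mathcal{F}_\mu$, with $a_{\underline i}$ smooth and $\partial_{\underline i}(\varphi_1,\dots,\varphi_m)=\varphi_1^{(i_1)}\cdots\varphi_m^{(i_m)}$; it is a $\mathrm{Vect}(M)$-module via $L_X^{\underline\lambda;\mu}(A)=L_X^\mu\circ A-\sum_{j=1}^m A(\dots,L_X^{\lambda_j}(-),\dots)$. $\mathcal{S}^{(j)}_{\lambda}$ is the direct sum of $\binom{j+m-1}{m-1}$ copies of $\mathcal{F}_\lambda$, indexed by the multi-indices of weight $j$. $\mathfrak{sl}(2)=\mathrm{Span}\{\partial_x,x\partial_x,x^2\partial_x\}\subset\mathrm{Vect}(M)$. Given non-singular matrices $[\beta]_p=(\beta^{\underline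 s}_{\underline i})_{|\underline s|=|\underline i|=p}$, $p=0,\dots,k$, the quantization map is $$Q^\beta_{\underline\lambda,\mu}\Big(\bigoplus_{|\underline i|\le k}a_{\underline i}(dx)^{\delta-|\underline i|}\Big)=\sum_{|\underline i|\le k}\ \sum_{|\underline i|\le|\underline s|\le k}\beta^{\underline s}_{\underline i}\,a_{\underline s}^{(|\underline s|-|\underline i|)}\,\partial_{\underline i},$$ where for $|\underline i|<|\underline s|$ the constants are determined by $(2\delta-1-|\underline s|-|\underline i|)(|\underline s|-|\underline i|)\beta^{\underline s}_{\underline i}+\sum_{j=1}^m(i_j+1)(2\lambda_j+i_j)\beta^{\underline s}_{\underline i+\mathbf 1_j}=0$; for $\delta\notin\{1,\frac32,\dots,k\}=\{\ell/2:\ell\in\mathbb{Z},2\le\ell\le2k\}$ this is well defined and $\mathfrak{sl}(2)$-equivariant. *)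

(* Defs.v *)
From HB Require Import structures.
From mathcomp Require Import all_boot all_order all_algebra.
From mathcomp Require Import all_classical all_reals all_analysis.

Set Implicit Arguments.
Unset Strict Implicit.
Unset Printing Implicit Defensive.

Import Order.TTheory GRing.Theory Num.Theory.
Import numFieldNormedType.Exports.

Local Open Scope ring_scope.

Definition smooth (R : realType) (f : R -> R) : Prop :=
  forall (n : nat) (x : R), derivable f^`(n)%classic x 1.

(* [Circle] is the projective line, covered by the affine coordinate x and the
   coordinate y = - 1 / x centred at infinity. *)
Inductive curve := Line | Circle.

(* [b (dy)^lambda] is the density [a (dx)^lambda] written in the coordinate
   y = - 1 / x: dx = (y ^ 2)^-1 dy, and this change of coordinate is orientation
   preserving, so that real powers of its Jacobian make sense. *)
Definition at_infinity (R : realType) (lambda : R) (a b : R -> R) : Prop :=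
  forall y : R, y != 0 -> b y = (y ^+ 2) `^ (- lambda) * a (- y^-1).

(* A density is represented by its coefficient in the coordinate x, which
   determines it on the circle too by continuity at infinity. *)
Definition density (R : realType) (M : curve) (lambda : R) (a : R -> R) : Prop :=
  smooth a /\
  (M = Circle -> exists b : R -> R, smooth b /\ at_infinity lambda a b).

(* [X] stands for the vector field X(x) d/dx; its coefficient changes under
   coordinate changes like that of a (-1)-density. *)
Definition vector_field (R : realType) (M : curve) (X : R -> R) : Prop :=
  density M (-1) X.

Definition Lie (R : realType) (lambda : R) (X a : R -> R) : R -> R :=
  fun x => X x * a^`()%classic x + lambda * X^`()%classic x * a x.

(* Every entry of a multi-index of weight at most k is at most k, so the
   multi-indices of weight at most k are the [i : midx m k] with [wt i <= k];
   the remaining elements of this type are never used. *)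
Definition midx (m k : nat) := {ffun 'I_m -> 'I_k.+1}.

Definition wt (m k : nat) (i : midx m k) : nat := (\sum_(j < m) i j)%N.

(* i + 1_j; there is no overflow as long as [wt i < k]. *)
Definition add1 (m k : nat) (i : midx m k) (j : 'I_m) : midx m k :=
  [ffun l => inord (i l + (l == j))].

Definition midx_wt (m k p : nat) : {set midx m k} := [set i | wt i == p]%SET.

(* m-ary operators are represented as functions of the m coefficients of their
   arguments in the coordinate x. *)
Definition operator (R : realType) (m : nat) := ('I_m -> R -> R) -> R -> R.

Definition partial (R : realType) (m k : nat) (i : midx m k) : operator R m :=
  fun phi x => \prod_(j < m) (phi j)^`(i j)%classic x.

Definition diff_op (R : realType) (m k : nat) (c : midx m k -> R -> R) :
    operator R m :=
  fun phi x => \sum_(i : midx m k | (wt i <= k)%N) c i x * partial i phi x.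

(* Membership in D^k_{lambda; mu}: the operator has smooth coefficients in the
   coordinate x and, on the circle, also in the coordinate at infinity. *)
Definition differential_operator (R : realType) (M : curve) (m k : nat)
    (lambda : 'rV[R]_m) (mu : R) (A : operator R m) : Prop :=
  (exists c : midx m k -> R -> R,
    (forall i, (wt i <= k)%N -> smooth (c i)) /\
    (forall phi, (forall j, density M (lambda 0 j) (phi j)) ->
       A phi = diff_op c phi)) /\
  (M = Circle -> exists d : midx m k -> R -> R,
    (forall i, (wt i <= k)%N -> smooth (d i)) /\
    (forall phi psi : 'I_m -> R -> R,
       (forall j, smooth (phi j) /\ smooth (psi j) /\
                  at_infinity (lambda 0 j) (phi j) (psi j)) ->
       at_infinity mu (A phi) (diff_op d psi))).

Definition Lie_operator (R : realType) (m : nat) (lambda : 'rV[R]_m) (mu : R)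
    (X : R -> R) (A : operator R m) : operator R m :=
  fun phi x => Lie mu X (A phi) x -
    \sum_(j < m)
      A (fun l => if l == j then Lie (lambda 0 l) X (phi l) else phi l) x.

(* Elements of the direct sum over 0 <= j <= k of S^(j)_{delta - j}. *)
Definition symbol (R : realType) (M : curve) (m k : nat) (delta : R)
    (a : midx m k -> R -> R) : Prop :=
  forall i, (wt i <= k)%N -> density M (delta - (wt i)%:R) (a i).

Definition Lie_symbol (R : realType) (m k : nat) (delta : R) (X : R -> R)
    (a : midx m k -> R -> R) : midx m k -> R -> R :=
  fun i => Lie (delta - (wt i)%:R) X (a i).

(* Throughout, [beta s i] is beta^s_i. *)
Definition beta_block (R : realType) (m k : nat)
    (beta : midx m k -> midx m k -> R) (p : nat) : 'M[R]_#|midx_wt m k p| :=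
  \matrix_(s, i) beta (enum_val s) (enum_val i).

Definition principal_symbol (R : realType) (m k : nat)
    (beta : midx m k -> midx m k -> R) : Prop :=
  forall p : nat, (p <= k)%N -> beta_block beta p \in unitmx.

(* When delta is not a half-integer between 1 and k, these equations have
   exactly one solution in the [beta s i], wt i < wt s, for every choice of the
   blocks of equal weight. *)
Definition sl2_recursion (R : realType) (m k : nat) (lambda : 'rV[R]_m)
    (delta : R) (beta : midx m k -> midx m k -> R) : Prop :=
  forall s i : midx m k, (wt s <= k)%N -> (wt i < wt s)%N ->
    (2 * delta - 1 - (wt s)%:R - (wt i)%:R) * ((wt s)%:R - (wt i)%:R) * beta s i
    + \sum_(j < m) ((i j)%:R + 1) * (2 * lambda 0 j + (i j)%:R)
                   * beta s (add1 i j) = 0.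

Definition quantization (R : realType) (m k : nat)
    (beta : midx m k -> midx m k -> R) (a : midx m k -> R -> R) : operator R m :=
  diff_op (fun i x =>
    \sum_(s : midx m k | (wt i <= wt s <= k)%N)
      beta s i * (a s)^`(wt s - wt i)%classic x).

(* Q is a Vect(M)-equivariant map from symbols to D^k_{lambda; mu}. *)
Definition Vect_equivariant (R : realType) (M : curve) (m k : nat)
    (lambda : 'rV[R]_m) (mu delta : R)
    (Q : (midx m k -> R -> R) -> operator R m) : Prop :=
  (forall a, symbol M delta a -> differential_operator M k lambda mu (Q a)) /\
  (forall X a phi,
     vector_field M X -> symbol M delta a ->
     (forall j, density M (lambda 0 j) (phi j)) ->
     Lie_operator lambda mu X (Q a) phi = Q (Lie_symbol delta X a) phi).

(* Main.v *)
(* Comparing, in Q (L_X a) phi = L_X (Q a) phi, the coefficients of X^(r)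
   turns Vect(M)-equivariance into linear equations on beta, one for each pair
   (s, i) and each 2 <= r <= |s| - |i| + 1; those with r = 2 are the sl(2)
   recursion. For k = 1 there are no others. For |s| = 2, i = 0, r = 3,
   eliminating beta^s_{1_j} and beta^s_0 by the recursion leaves a linear relation
   between the beta^s_{1_j + 1_l}, which by non-singularity of [beta]_2 must be
   trivial: lambda_j lambda_l = 0 for j <> l and
   lambda_j (lambda_j + delta - 1) = 0. For |s| = 3, the equations at
   i = 1_l, 2 1_l then give (delta - 1) beta^s_{3 1_l} = 0 for a suitable l and
   all s, contradicting the non-singularity of [beta]_3.
   On the circle, the coordinate change y = - 1 / x acts on jets through the
   exponential of the lowering operator attached to x^2 d/dx, so the r = 2
   equations make Q commute with it. *)
Require Import Defs.
From HB Require Import structures.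
From mathcomp Require Import all_boot all_order all_algebra.
From mathcomp Require Import all_classical all_reals all_analysis.
From mathcomp Require Import ring zify.

Set Implicit Arguments.
Unset Strict Implicit.
Unset Printing Implicit Defensive.

Import Order.TTheory GRing.Theory Num.Theory.
Import numFieldNormedType.Exports.

Local Open Scope ring_scope.

(** * Iterated derivatives *)

Lemma is_derive_congr (R : realType) (f g : R -> R) (x d e : R) :
  f =1 g -> d = e -> is_derive x 1 f d -> is_derive x 1 g e.
Proof. by move=> /funext -> ->. Qed.

Lemma derive1n_is_derive (R : realType) (f : R -> R) (n : nat) (x : R) :
  smooth f -> is_derive x 1 f^`(n)%classic (f^`(n.+1)%classic x).
Proof.
by move=> sf; rewrite derive1nS derive1E; apply: DeriveDef => //; exact: sf.
Qed.

(** A conjectured closed form for all orders has to be checked only one differentiation at a time;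
    [bell] and [Lie] are treated this way. *)
Lemma tower_derive1n (R : realType) (F : nat -> R -> R) :
  (forall n (x : R), is_derive x 1 (F n) (F n.+1 x)) ->
  forall n, (F 0%N)^`(n)%classic = F n.
Proof.
move=> hF; elim=> [|n ih]; first by rewrite derive1n0.
rewrite derive1nS ih; apply/funext => x.
by rewrite derive1E (@derive_val _ _ _ _ _ _ _ (hF n x)).
Qed.

Lemma tower_smooth (R : realType) (F : nat -> R -> R) :
  (forall n (x : R), is_derive x 1 (F n) (F n.+1 x)) -> smooth (F 0%N).
Proof.
by move=> hF n x; rewrite tower_derive1n//; case: (hF n x).
Qed.

Lemma is_derive_addf (R : realType) (f g : R -> R) (x df dg : R) :
  is_derive x 1 f df -> is_derive x 1 g dg ->
  is_derive x 1 (fun y => f y + g y) (df + dg).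
Proof. by move=> hf hg; exact: is_deriveD. Qed.

Lemma is_derive_mulf (R : realType) (f g : R -> R) (x df dg : R) :
  is_derive x 1 f df -> is_derive x 1 g dg ->
  is_derive x 1 (fun y => f y * g y) (df * g x + f x * dg).
Proof.
move=> hf hg; apply: is_derive_congr (is_deriveM hf hg) => //.
by rewrite addrC; congr (_ + _); exact: mulrC.
Qed.

Lemma is_derive_mull (R : realType) (c : R) (f : R -> R) (x df : R) :
  is_derive x 1 f df -> is_derive x 1 (fun y => c * f y) (c * df).
Proof.
move=> hf; apply: is_derive_congr (is_derive_mulf (is_derive_cst c x 1) hf) => //.
by rewrite mul0r add0r.
Qed.

Lemma is_derive_bigsum (R : realType) (I : Type) (r : seq I) (P : pred I)
    (f : I -> R -> R) (x : R) (df : I -> R) :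
  (forall i, P i -> is_derive x 1 (f i) (df i)) ->
  is_derive x 1 (fun y => \sum_(i <- r | P i) f i y) (\sum_(i <- r | P i) df i).
Proof.
move=> hf; elim: r => [|i r ih].
  by apply: is_derive_congr (is_derive_cst (0 : R) x 1) => [y|]; rewrite big_nil.
rewrite big_cons; case: ifP => Pi.
  by apply: is_derive_congr (is_derive_addf (hf _ Pi) ih) => // y;
     rewrite big_cons Pi.
by apply: is_derive_congr ih => // y; rewrite big_cons Pi.
Qed.

Lemma is_derive_bigprod (R : realType) (m : nat) (f : 'I_m -> R -> R) (x : R)
    (df : 'I_m -> R) :
  (forall j, is_derive x 1 (f j) (df j)) ->
  is_derive x 1 (fun y => \prod_(j < m) f j y)
    (\sum_(j < m) \prod_(l < m) (if l == j then df l else f l x)).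
Proof.
elim: m f df => [|m ih] f df hf.
  rewrite big_ord0; apply: is_derive_congr (is_derive_cst (1 : R) x 1) => // y.
  by rewrite big_ord0.
have := is_derive_mulf (hf ord0) (ih _ _ (fun j => hf (lift ord0 j))).
apply: is_derive_congr => [y|]; first by rewrite big_ord_recl.
rewrite big_ord_recl; congr (_ + _).
  by rewrite big_ord_recl /=; congr (_ * _); apply: eq_bigr.
rewrite big_distrr; apply: eq_bigr => j _; rewrite [RHS]big_ord_recl /=.
by congr (_ * _).
Qed.

Lemma is_derive_1sqr_powR (R : realType) (nu x : R) :
  is_derive x 1 (fun y : R => (1 + y ^+ 2) `^ nu)
    (nu * (1 + x ^+ 2) `^ (nu - 1) * (2 * x)).
Proof.
have pos : 0 < 1 + x ^+ 2 by apply: ltr_wpDr; rewrite ?sqr_ge0.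
have h : is_derive x 1 (fun y : R => 1 + y ^+ 2) (2 * x).
  apply: is_derive_congr (is_derive_poly (1 + 'X^2) x) => [y|].
    by rewrite !hornerE.
  by rewrite derivD derivXn derivC !hornerE /= mulr_natl.
exact: (@is_derive1_comp _ (fun z => z `^ nu) (fun y => 1 + y ^+ 2) _ _ _
  (is_derive1_powR nu pos) h).
Qed.

Lemma is_derive_sqr_powR (R : realType) (nu x : R) : x != 0 ->
  is_derive x 1 (fun y : R => (y ^+ 2) `^ nu)
    (nu * (x ^+ 2) `^ (nu - 1) * (2 * x)).
Proof.
move=> x0; have pos : 0 < x ^+ 2 by rewrite exprn_even_gt0.
have h : is_derive x 1 (fun y : R => y ^+ 2) (2 * x).
  apply: is_derive_congr (is_derive_poly ('X^2) x) => [y|].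
    by rewrite !hornerE.
  by rewrite derivXn !hornerE /= mulr_natl.
exact: (@is_derive1_comp _ (fun z => z `^ nu) (fun y => y ^+ 2) _ _ _
  (is_derive1_powR nu pos) h).
Qed.

Lemma is_derive_oppV (R : realType) (x : R) : x != 0 ->
  is_derive x 1 (fun y : R => - y^-1) (x ^- 2).
Proof.
move=> x0; have := is_derive_mull (-1) (@is_deriveV _ id x 1 1 x0 (is_derive_id x 1)).
by apply: is_derive_congr => [y|]; rewrite mulN1r// scaleNr opprK; exact: mulr1.
Qed.

(** * Densities with prescribed jet at the origin *)

(** The polynomial left in the [n]-th derivative of [p (1 + x^2)^nu] once [(1 + x^2)^(nu - n)] is
    factored out. *)
Fixpoint bell_numerator (R : realType) (nu : R) (p : {poly R}) (n : nat) :
    {poly R} :=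
  if n is n'.+1 then
    (bell_numerator nu p n')^`() * (1 + 'X^2) +
    (2 * (nu - n'%:R)) *: ('X * bell_numerator nu p n')
  else p.

(* For [nu = - lambda - q] and [p] of degree at most [2 q] this is a
   [lambda]-density on both curves (on the circle, a smooth function times the
   invariant density [(dx / (1 + x ^ 2)) ^ lambda]); its jet at 0 is arbitrary
   up to order [q], which replaces bump functions. *)
Definition bell (R : realType) (nu : R) (p : {poly R}) : R -> R :=
  fun x => p.[x] * (1 + x ^+ 2) `^ nu.

Lemma is_derive_bell (R : realType) (nu : R) (p : {poly R}) (n : nat) (x : R) :
  is_derive x 1 (bell (nu - n%:R) (bell_numerator nu p n))
    (bell (nu - n.+1%:R) (bell_numerator nu p n.+1) x).
Proof.
have := is_derive_mulf (is_derive_poly (bell_numerator nu p n) x)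
          (is_derive_1sqr_powR (nu - n%:R) x).
apply: is_derive_congr => //; rewrite /bell /=.
have x0 : 1 + x ^+ 2 != 0 :> R by rewrite gt_eqF// ltr_wpDr ?sqr_ge0.
have -> : nu - n.+1%:R = nu - n%:R - 1 :> R by rewrite -natr1; ring.
have -> : (1 + x ^+ 2) `^ (nu - n%:R) =
          (1 + x ^+ 2) * (1 + x ^+ 2) `^ (nu - n%:R - 1).
  rewrite -{2}[1 + x ^+ 2]powRr1 ?addr_ge0 ?sqr_ge0// -powRD ?x0 ?implybT//.
  by congr (_ `^ _); ring.
rewrite !(hornerE, hornerXn) /=; set w := _ `^ _; ring.
Qed.

Lemma derive1n_bell (R : realType) (nu : R) (p : {poly R}) (n : nat) :
  (bell nu p)^`(n)%classic = bell (nu - n%:R) (bell_numerator nu p n).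
Proof.
rewrite -[in LHS](subr0 nu).
exact: (tower_derive1n (is_derive_bell nu p) n).
Qed.

Lemma bell_smooth (R : realType) (nu : R) (p : {poly R}) : smooth (bell nu p).
Proof.
rewrite -(subr0 nu); exact: (tower_smooth (is_derive_bell nu p)).
Qed.

(** With [x = - 1 / y] one has [1 + x^2 = (1 + y^2) / y^2]. The powers of [y^2] collapse to
    [y^(2 q)], and [y^(2 q) p(- 1 / y)] is a polynomial because [p] has degree at most [2 q]. *)
Lemma bell_density (R : realType) (M : curve) (lambda : R) (q : nat)
    (p : {poly R}) :
  (size p <= q.*2.+1)%N -> density M lambda (bell (- lambda - q%:R) p).
Proof.
move=> sp; split; first exact: bell_smooth.
move=> _.
exists (bell (- lambda - q%:R)
  (\sum_(i < size p) (p`_i * (-1) ^+ i) *: 'X^(q.*2 - i))).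
split; first exact: bell_smooth.
move=> y y0; rewrite /bell.
have y2 : 0 < y ^+ 2 by rewrite exprn_even_gt0.
have y2n : y ^+ 2 != 0 by rewrite gt_eqF.
have z2 : 0 < 1 + y ^+ 2 by rewrite ltr_wpDr ?sqr_ge0.
have -> : 1 + (- y^-1) ^+ 2 = (1 + y ^+ 2) * (y ^+ 2)^-1 by field.
have inv_pow nu : (y ^+ 2)^-1 `^ nu = (y ^+ 2) `^ (- nu).
  by rewrite -powR_inv1 ?ltW// -powRrM mulN1r.
rewrite powRM ?invr_ge0 ?ltW// inv_pow.
have pow_q : (y ^+ 2) `^ (- (- lambda - q%:R)) = (y ^+ 2) `^ lambda * y ^+ q.*2.
  have -> : - (- lambda - q%:R) = lambda + q%:R :> R by ring.
  by rewrite powRD ?y2n ?implybT// powR_mulrn ?ltW// -exprM mul2n.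
have B0 : (y ^+ 2) `^ lambda != 0 by rewrite powR_eq0 negb_and y2n.
have -> : (\sum_(i < size p) (p`_i * (-1) ^+ i) *: 'X^(q.*2 - i)).[y] =
          p.[- y^-1] * y ^+ q.*2.
  rewrite horner_sum horner_coef mulr_suml; apply: eq_bigr => i _.
  rewrite hornerZ hornerXn -!mulrA; congr (_ * _).
  have le_i : (i <= q.*2)%N by rewrite -ltnS (leq_trans (ltn_ord i)).
  rewrite -{2}(subnK le_i) exprD (exprNn y^-1) exprVn.
  by rewrite -!mulrA; congr (_ * _); rewrite mulrCA mulVf ?mulr1// expf_neq0.
by rewrite pow_q powRN; field.
Qed.

Lemma bell_numeratorD (R : realType) (nu : R) (p q : {poly R}) (n : nat) :
  bell_numerator nu (p + q) n = bell_numerator nu p n + bell_numerator nu q n.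
Proof.
by elim: n => //= n ->; rewrite derivD -!mul_polyC; ring.
Qed.

Lemma bell_numeratorZ (R : realType) (nu c : R) (p : {poly R}) (n : nat) :
  bell_numerator nu (c *: p) n = c *: bell_numerator nu p n.
Proof.
by elim: n => //= n ->; rewrite derivZ -!mul_polyC; ring.
Qed.

(** Each differentiation removes one power of [X] and multiplies the constant term of the cofactor
    by the exponent, so [c = (n + r)! / r!]. Hence jets at 0 depend on the coefficients of [p] in a
    triangular way, with non-zero diagonal. *)
Lemma bell_numerator_mulXn (R : realType) (nu : R) (r n : nat) (p : {poly R}) :
  exists2 q : {poly R}, bell_numerator nu ('X^(n + r) * p) n = 'X^r * q &
    exists2 c : R, c != 0 & q.[0] = c * p.[0].
Proof.
elim: n r => [|n ih] r.
  by exists p => //; exists 1; rewrite ?mul1r ?oner_neq0.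
rewrite addSnnS /=; have [q -> [c c0 q0]] := ih r.+1.
exists (r.+1%:R *: (q * (1 + 'X^2)) + 'X * (q^`() * (1 + 'X^2)) +
        (2 * (nu - n%:R)) *: ('X^2 * q)).
  by rewrite derivM derivXn /= -!mul_polyC !exprS -mulr_natl rmorph_nat; ring.
exists (r.+1%:R * c); first by rewrite mulf_neq0// pnatr_eq0.
by rewrite !hornerE /= q0; ring.
Qed.

Lemma density_jet (R : realType) (M : curve) (lambda : R) (N : nat)
    (v : nat -> R) :
  exists f : R -> R, density M lambda f /\
    forall n, (n <= N)%N -> f^`(n)%classic 0 = v n.
Proof.
pose nu := - lambda - N%:R.
suff [p sp hp] : exists2 p : {poly R}, (size p <= N.+1)%N &
    forall n, (n < N.+1)%N -> (bell_numerator nu p n).[0] = v n.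
  exists (bell nu p); split.
    by apply: bell_density; apply: leq_trans sp _; rewrite ltnS -addnn leq_addr.
  by move=> n nN; rewrite derive1n_bell /bell hp// expr0n /= addr0 powR1 mulr1.
elim: N.+1 => [|K [p sp hp]]; first by exists 0; rewrite ?size_poly0.
have [q] := bell_numerator_mulXn nu 0 K 1; rewrite addn0 mulr1 mul1r => Kq.
case=> c c0; rewrite hornerC mulr1 => q0.
(* Adding a multiple of [X^K] keeps the orders below [K], already matched; [d] corrects order
   [K]. *)
pose d := (v K - (bell_numerator nu p K).[0]) / c.
exists (p + d *: 'X^K).
  rewrite (leq_trans (size_polyD _ _))// geq_max (leq_trans sp)//=.
  by rewrite (leq_trans (size_scale_leq _ _))// size_polyXn.
move=> n; rewrite ltnS leq_eqVlt bell_numeratorD bell_numeratorZ hornerD hornerZ.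
case/orP=> [/eqP ->|nK]; first by rewrite Kq q0 /d divfK// addrC subrK.
have [q'] := bell_numerator_mulXn nu (K - n) n 1.
rewrite subnKC ?(ltnW nK)// mulr1 => -> _; rewrite hp// hornerM hornerXn expr0n.
by rewrite subn_eq0 leqNgt nK mul0r mulr0 addr0.
Qed.

(** * Multi-indices and forms on jets *)

Lemma leq_midx_wt (m k : nat) (i : midx m k) (l : 'I_m) : (i l <= wt i)%N.
Proof. by rewrite /wt (bigD1 l)//= leq_addr. Qed.

(** The multi-index [i + r 1_j]. An overflowing entry would be sent to 0 by [inord]; the bound
    [wt i + r <= k] in the lemmas rules this out. *)
Definition shift_midx (m k : nat) (r : nat) (j : 'I_m) (i : midx m k) :
    midx m k :=
  [ffun l => inord (i l + (l == j) * r)].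

Definition unshift_midx (m k : nat) (r : nat) (j : 'I_m) (i : midx m k) :
    midx m k :=
  [ffun l => inord (i l - (l == j) * r)].

Lemma add1_shift (m k : nat) (j : 'I_m) (i : midx m k) :
  add1 i j = shift_midx 1 j i.
Proof. by apply/ffunP => l; rewrite !ffunE muln1. Qed.

Lemma shift_midxE (m k r : nat) (j l : 'I_m) (i : midx m k) :
  (wt i + r <= k)%N -> shift_midx r j i l = (i l + (l == j) * r)%N :> nat.
Proof.
move=> ir; rewrite ffunE inordK// ltnS (leq_trans _ ir)// leq_add ?leq_midx_wt//.
by case: (l == j); rewrite ?mul1n.
Qed.

Lemma wt_shift_midx (m k r : nat) (j : 'I_m) (i : midx m k) :
  (wt i + r <= k)%N -> wt (shift_midx r j i) = (wt i + r)%N.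
Proof.
move=> ir; rewrite /wt.
under eq_bigr do rewrite shift_midxE//.
rewrite big_split /= -big_distrl /=; congr (_ + _)%N.
by rewrite (bigD1 j)//= eqxx big1 ?mul1n// => l /negPf ->.
Qed.

Lemma unshift_midxE (m k r : nat) (j l : 'I_m) (i : midx m k) :
  unshift_midx r j i l = (i l - (l == j) * r)%N :> nat.
Proof.
by rewrite ffunE inordK// ltnS (leq_trans (leq_subr _ _))// -ltnS ltn_ord.
Qed.

Lemma unshift_midxK (m k r : nat) (j : 'I_m) (i : midx m k) :
  (r <= i j)%N -> shift_midx r j (unshift_midx r j i) = i.
Proof.
move=> rij; apply/ffunP => l; apply/val_inj.
rewrite /= ffunE unshift_midxE subnK ?inordK//.
by have [->|] := eqVneq l j; rewrite ?mul1n.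
Qed.

Lemma wt_unshift_midx (m k r : nat) (j : 'I_m) (i : midx m k) :
  (r <= i j)%N -> (wt (unshift_midx r j i) + r)%N = wt i.
Proof.
move=> rij; rewrite /wt.
under eq_bigr do rewrite unshift_midxE.
rewrite (bigD1 j)//= [RHS](bigD1 j)//= eqxx mul1n addnAC subnK//.
by congr (_ + _)%N; apply: eq_bigr => l /negPf ->; rewrite subn0.
Qed.

Lemma shift_midxK (m k r : nat) (j : 'I_m) (i : midx m k) :
  (wt i + r <= k)%N -> unshift_midx r j (shift_midx r j i) = i.
Proof.
move=> ir; apply/ffunP => l; apply/val_inj.
by rewrite /= unshift_midxE shift_midxE// addnK.
Qed.

(** Moves an operator that lowers the order of one argument by [r] from the jet of this argument to
    the coefficients. *)
Lemma reindex_shift_midx (R : realType) (m k r : nat) (j : 'I_m)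
    (G : midx m k -> R) :
  (forall i : midx m k, (i j < r)%N -> G i = 0) ->
  \sum_(i : midx m k | (wt i <= k)%N) G i =
  \sum_(i : midx m k | (wt i + r <= k)%N) G (shift_midx r j i).
Proof.
move=> G0; rewrite (bigID (fun i : midx m k => (r <= i j)%N)) /=.
rewrite [X in _ + X]big1 ?addr0; last first.
  by move=> i /andP[_]; rewrite -ltnNge => /G0.
rewrite (reindex_onto (shift_midx r j) (unshift_midx r j)) /=; last first.
  by move=> i /andP[_]; exact: unshift_midxK.
apply: eq_bigl => i; apply/idP/idP => [/andP[/andP[wk rj] /eqP <-]|ir].
  by rewrite wt_unshift_midx.
rewrite wt_shift_midx// ir shift_midxK// eqxx shift_midxE// eqxx mul1n.
by rewrite leq_addl.
Qed.

Section JetForm.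
Variables (R : realType) (m k : nat).
Implicit Types (beta : midx m k -> midx m k -> R) (alpha : midx m k -> nat -> R).
Implicit Types (phi f : 'I_m -> nat -> R).

(* The coefficient of [X^(r)] in the [n]-th derivative of [Lie nu X f], as a
   function of the jet of [f]. *)
Definition jet_lower (r : nat) (nu : R) (f : nat -> R) : nat -> R :=
  fun n => if r is r'.+1 then
             ('C(n, r'.+1)%:R + nu * 'C(n, r')%:R) * f (n - r')%N
           else f n.+1.

(** The value of [quantization] at a point, with the derivatives of the symbol and of the arguments
    replaced by free sequences. *)
Definition jet_form beta alpha phi : R :=
  \sum_(i : midx m k | (wt i <= k)%N)
    (\sum_(s : midx m k | (wt i <= wt s <= k)%N) beta s i * alpha s (wt s - wt i)%N) *
    \prod_(j < m) phi j (i j).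

Definition upd (T : Type) (phi f : 'I_m -> T) (j : 'I_m) : 'I_m -> T :=
  fun l => if l == j then f l else phi l.

(* The coefficient of [X^(r)] in [Q (L_X a) + \sum_j Q a (.., L_X phi_j, ..)]. *)
Definition jet_variation (lambda : 'rV[R]_m) (delta : R) (r : nat)
    beta alpha phi : R :=
  jet_form beta (fun s => jet_lower r (delta - (wt s)%:R) (alpha s)) phi +
  \sum_(j < m)
    jet_form beta alpha (upd phi (fun l => jet_lower r (lambda 0 l) (phi l)) j).

(* Its coefficients, for [jet_variation] of order [r.+1]: order 2 gives half of
   the left-hand side of [sl2_recursion]. *)
Definition defect (lambda : 'rV[R]_m) (delta : R) (r : nat) beta
    (s i : midx m k) : R :=
  ('C(wt s - wt i, r.+1)%:R + (delta - (wt s)%:R) * 'C(wt s - wt i, r)%:R) *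
    beta s i +
  \sum_(j < m)
    ('C(i j + r, r.+1)%:R + lambda 0 j * 'C(i j + r, r)%:R) *
    beta s (shift_midx r j i).

Lemma jet_form_eq beta alpha alpha' phi phi' :
  (forall s n, (wt s <= k)%N -> (n <= k)%N -> alpha s n = alpha' s n) ->
  (forall j n, (n <= k)%N -> phi j n = phi' j n) ->
  jet_form beta alpha phi = jet_form beta alpha' phi'.
Proof.
move=> ha hp; apply: eq_bigr => i ik; congr (_ * _).
  apply: eq_bigr => s /andP[_ sk]; rewrite ha//.
  by rewrite (leq_trans (leq_subr _ _)).
by apply: eq_bigr => j _; rewrite hp// -ltnS ltn_ord.
Qed.

Lemma jet_form_suml beta (N : nat) (c : 'I_N -> R)
    (alpha : 'I_N -> midx m k -> nat -> R) phi :
  jet_form beta (fun s n => \sum_(r < N) c r * alpha r s n) phi =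
  \sum_(r < N) c r * jet_form beta (alpha r) phi.
Proof.
under [RHS]eq_bigr do rewrite big_distrr /=.
rewrite exchange_big; apply: eq_bigr => i _ /=.
under [RHS]eq_bigr do rewrite mulrA big_distrr /=.
rewrite -big_distrl /= exchange_big; congr (_ * _); apply: eq_bigr => s _ /=.
by rewrite big_distrr; apply: eq_bigr => r _ /=; rewrite mulrCA.
Qed.

Lemma prod_upd phi f (j : 'I_m) (i : midx m k) :
  \prod_(l < m) upd phi f j l (i l) =
  f j (i j) * \prod_(l < m | l != j) phi l (i l).
Proof.
rewrite (bigD1 j)//= /upd eqxx; congr (_ * _).
by apply: eq_bigr => l /negPf ->.
Qed.

Lemma jet_form_upd_sum beta (N : nat) (c : 'I_N -> R) alpha phi
    (f : 'I_N -> 'I_m -> nat -> R) (j : 'I_m) :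
  jet_form beta alpha (upd phi (fun l n => \sum_(r < N) c r * f r l n) j) =
  \sum_(r < N) c r * jet_form beta alpha (upd phi (f r) j).
Proof.
under [RHS]eq_bigr do rewrite big_distrr /=.
rewrite exchange_big; apply: eq_bigr => i _ /=.
under [RHS]eq_bigr do rewrite prod_upd.
rewrite prod_upd; move: (\sum_(s | _) _) => A.
rewrite mulr_suml mulr_sumr; apply: eq_bigr => r _; ring.
Qed.

(** [jet_lower r.+1] lowers the order by [r] and vanishes at orders below [r]. On [alpha] it leaves
    the pairs with [wt i + r <= wt s]; on [phi j] it is absorbed by substituting [i + r 1_j] for
    [i]. Both contributions then multiply the same monomials. *)
Lemma jet_variationE lambda delta r beta alpha phi :
  jet_variation lambda delta r.+1 beta alpha phi =
  \sum_(i : midx m k | (wt i <= k)%N)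
    (\sum_(s : midx m k | (wt i + r <= wt s <= k)%N)
       defect lambda delta r beta s i * alpha s (wt s - wt i - r)%N) *
    \prod_(j < m) phi j (i j).
Proof.
have lower_lt (g : nat -> R) (nu : R) (n : nat) :
    (n < r)%N -> jet_lower r.+1 nu g n = 0.
  by move=> nr; rewrite /= !bin_small// ?mulr0 ?addr0 ?mul0r// ltnW.
have first : jet_form beta
    (fun s => jet_lower r.+1 (delta - (wt s)%:R) (alpha s)) phi =
  \sum_(i : midx m k | (wt i <= k)%N)
    (\sum_(s : midx m k | (wt i + r <= wt s <= k)%N)
       ('C(wt s - wt i, r.+1)%:R + (delta - (wt s)%:R) * 'C(wt s - wt i, r)%:R) *
        beta s i * alpha s (wt s - wt i - r)%N) *
    \prod_(j < m) phi j (i j).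
  apply: eq_bigr => i ik; congr (_ * _).
  rewrite (bigID (fun s => wt i + r <= wt s)%N) /= [X in _ + X]big1 ?addr0.
    apply: eq_big => [s|s _]; last by rewrite mulrCA mulrA.
    case: (leqP (wt i + r) (wt s)) => [h|]; rewrite ?andbF ?andbT//.
    by rewrite (leq_trans _ h)// leq_addr.
  move=> s /andP[/andP[is_ _]]; rewrite -ltnNge => sr.
  by rewrite -/(jet_lower r.+1 _ _ _) lower_lt ?mulr0// ltn_subLR.
have second (j : 'I_m) :
  jet_form beta alpha (upd phi (fun l => jet_lower r.+1 (lambda 0 l) (phi l)) j) =
  \sum_(i : midx m k | (wt i <= k)%N)
    (\sum_(s : midx m k | (wt i + r <= wt s <= k)%N)
       ('C(i j + r, r.+1)%:R + lambda 0 j * 'C(i j + r, r)%:R) *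
       beta s (shift_midx r j i) * alpha s (wt s - wt i - r)%N) *
    \prod_(j < m) phi j (i j).
  rewrite /jet_form (@reindex_shift_midx _ _ _ r j); last first.
    move=> i ijr; rewrite prod_upd.
    by rewrite lower_lt// mul0r mulr0.
  rewrite [RHS](bigID (fun i => wt i + r <= k)%N) /= [X in _ = _ + X]big1 ?addr0.
    apply: eq_big => [i|i ir].
      case: (leqP (wt i + r) k) => [h|]; rewrite ?andbF ?andbT//.
      by rewrite (leq_trans _ h)// leq_addr.
    rewrite wt_shift_midx// prod_upd.
    rewrite [in RHS](bigD1 j)//= shift_midxE// eqxx mul1n addnK.
    under [in LHS]eq_bigr => l lj do
      rewrite shift_midxE// (negPf lj) addn0.
    rewrite -[_ * phi j _ * _]mulrA mulrA; congr (_ * _); rewrite mulr_suml.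
    by apply: eq_bigr => s _; rewrite subnDA; ring.
  move=> i /andP[_]; rewrite -ltnNge => ir; rewrite big1 ?mul0r// => s /andP[h1 h2].
  by have := leq_trans h1 h2; rewrite leqNgt ir.
rewrite /jet_variation first (eq_bigr _ (fun j _ => second j)) exchange_big /=.
rewrite -big_split; apply: eq_bigr => i _ /=.
rewrite -mulr_suml -mulrDl exchange_big -big_split; congr (_ * _).
apply: eq_bigr => s _ /=.
by rewrite /defect [RHS]mulrDl mulr_suml.
Qed.

End JetForm.

(** * The Lie derivative of a quantization *)

Definition jet (R : realType) (f : R -> R) (x : R) : nat -> R :=
  fun n => f^`(n)%classic x.

Lemma jet_lower_gt (R : realType) (r n : nat) (nu : R) (f : nat -> R) :
  (n.+1 < r)%N -> jet_lower r nu f n = 0.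
Proof.
by case: r => // r nr; rewrite /= !bin_small ?(ltnW nr)// mulr0 addr0 mul0r.
Qed.

(** Leibniz rule: one more derivative falls either on the factor [X^(r)] or on the jet of [f]. On
    binomials this is Pascal's rule. *)
Lemma jet_lowerS (R : realType) (r n : nat) (nu : R) (f : nat -> R) :
  jet_lower r.+1 nu f n.+1 =
  jet_lower r nu f n + jet_lower r.+1 nu (fun l => f l.+1) n.
Proof.
case: r => [|r] /=; first by rewrite !bin0 !bin1 !subn0 -natr1; ring.
(* For [n <= r] truncated subtraction gives the last term a wrong index, but its coefficient is
   zero. *)
have [nr|rn] := ltnP n r.+1; last by rewrite !binS -subSn// subSS !natrD; ring.
rewrite (@bin_small n r.+1)// (@bin_small n r.+2)// 1?ltnW//.
by rewrite !binS (@bin_small n r.+1)// (@bin_small n r.+2) 1?ltnW// subSS !natrD; ring.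
Qed.

Lemma is_derive_jet_lower (R : realType) (r n : nat) (nu : R)
    (f : R -> nat -> R) (df : nat -> R) (x : R) :
  (forall l, is_derive x 1 (fun y => f y l) (df l)) ->
  is_derive x 1 (fun y => jet_lower r nu (f y) n) (jet_lower r nu df n).
Proof. by move=> hf; case: r => [|r] //=; exact: is_derive_mull. Qed.

(** Only [r <= n + 1] contributes. Allowing any larger [N] gives all the orders up to [k] a common
    range of summation. *)
Lemma jet_Lie (R : realType) (N n : nat) (nu : R) (X a : R -> R) (x : R) :
  smooth X -> smooth a -> (n.+1 < N)%N ->
  jet (Lie nu X a) x n = \sum_(r < N) jet X x r * jet_lower r nu (jet a x) n.
Proof.
move=> sX sa nN.
pose F n x := \sum_(r < n.+2) jet X x r * jet_lower r nu (jet a x) n.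
have F0 : Lie nu X a = F 0%N.
  apply/funext => y; rewrite /F big_ord_recl big_ord1 /= /Lie /jet.
  rewrite addn0 bin0 bin_small// add0r mulr1 mulrA; congr (_ + _).
  by rewrite [RHS]mulrAC [RHS]mulrC mulrA [nu * _]mulrC.
have FS l (y : R) : is_derive y 1 (F l) (F l.+1 y).
  have term (r : nat) : is_derive y 1
      (fun z => jet X z r * jet_lower r nu (jet a z) l)
      (jet X y r.+1 * jet_lower r nu (jet a y) l +
       jet X y r * jet_lower r nu (fun n => jet a y n.+1) l).
    apply: is_derive_mulf; first exact: derive1n_is_derive.
    by apply: is_derive_jet_lower => q; exact: derive1n_is_derive.
  have := is_derive_bigsum (index_enum 'I_l.+2) (P := xpredT)
    (fun r _ => term r).
  apply: is_derive_congr => //.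
  rewrite big_split /F [in RHS]big_ord_recl.
  under [in RHS]eq_bigr do rewrite lift0 jet_lowerS mulrDr.
  rewrite big_split [RHS]addrCA; congr (_ + _).
  rewrite [in LHS]big_ord_recl [in RHS]big_ord_recr.
  rewrite [X in _ = _ + (_ + X)]mulrC (@jet_lower_gt _ l.+2)// mul0r addr0.
  by congr (_ + _); apply: eq_bigr => r _; rewrite lift0.
rewrite /jet F0 tower_derive1n// /F.
rewrite (big_ord_widen N (fun r => jet X x r * jet_lower r nu (jet a x) n))//.
rewrite [RHS](bigID (fun r : 'I_N => r < n.+2)%N) /= [X in _ = _ + X]big1 ?addr0//.
by move=> r; rewrite -leqNgt => hr; rewrite jet_lower_gt// mulr0.
Qed.

Section JetFormAnalysis.
Variables (R : realType) (m k : nat) (beta : midx m k -> midx m k -> R).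

Lemma is_derive_jet_form (alpha : R -> midx m k -> nat -> R)
    (dalpha : midx m k -> nat -> R) (phi : R -> 'I_m -> nat -> R)
    (dphi : 'I_m -> nat -> R) (x : R) :
  (forall s n, (wt s <= k)%N ->
     is_derive x 1 (fun y => alpha y s n) (dalpha s n)) ->
  (forall j n, is_derive x 1 (fun y => phi y j n) (dphi j n)) ->
  is_derive x 1 (fun y => jet_form beta (alpha y) (phi y))
    (jet_form beta dalpha (phi x) +
     \sum_(j < m) jet_form beta (alpha x) (upd (phi x) dphi j)).
Proof.
move=> ha hp.
have hc (i : midx m k) : is_derive x 1
    (fun y => \sum_(s : midx m k | (wt i <= wt s <= k)%N)
       beta s i * alpha y s (wt s - wt i)%N)
    (\sum_(s : midx m k | (wt i <= wt s <= k)%N)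
       beta s i * dalpha s (wt s - wt i)%N).
  by apply: is_derive_bigsum => s /andP[_ sk]; apply: is_derive_mull; exact: ha.
have := is_derive_bigsum (index_enum (midx m k)) (P := fun i => (wt i <= k)%N)
  (fun i _ => is_derive_mulf (hc i) (is_derive_bigprod (fun j => hp j (i j)))).
apply: is_derive_congr => //.
rewrite big_split; congr (_ + _); rewrite /= exchange_big /=.
apply: eq_bigr => i _; rewrite big_distrr; apply: eq_bigr => j _ /=.
by congr (_ * _); apply: eq_bigr => l _; rewrite /upd; case: ifP.
Qed.

Lemma quantizationE (a : midx m k -> R -> R) (phi : 'I_m -> R -> R) (x : R) :
  quantization beta a phi x =
  jet_form beta (fun s => jet (a s) x) (fun j => jet (phi j) x).
Proof. by []. Qed.

Variables (lambda : 'rV[R]_m) (mu delta : R).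
Hypothesis hdelta : delta = mu - \sum_(j < m) lambda 0 j.

(** The coefficient of [X'] counts weights: [delta - |s|] from the symbol, [|s| - |i|] from its
    derivatives, and [lambda_j + i_j] from each argument add up to [mu]. *)
Lemma jet_variation1 (alpha : midx m k -> nat -> R) (phi : 'I_m -> nat -> R) :
  jet_variation lambda delta 1 beta alpha phi = mu * jet_form beta alpha phi.
Proof.
rewrite jet_variationE big_distrr; apply: eq_bigr => i _ /=; rewrite mulrA.
congr (_ * _); rewrite big_distrr /=.
apply: eq_big => [s|s /andP[is_ _]]; first by rewrite addn0.
rewrite subn0 mulrA; congr (_ * _); rewrite /defect bin1 bin0.
have shift0 j : shift_midx 0 j i = i.
  by apply/ffunP => l; rewrite ffunE muln0 addn0 inord_val.
under eq_bigr do rewrite shift0 addn0 bin1 bin0 mulr1.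
rewrite -mulr_suml -mulrDl big_split /= -natr_sum; congr (_ * _).
rewrite addn0 in is_; rewrite -/(wt i) hdelta natrB//; ring.
Qed.

(** The terms in [X] and [X'] cancel: order 0 is the derivative of [quantization beta a phi], order
    1 its multiple by [mu]. What is left starts at the second derivative of [X]. *)
Lemma Lie_quantization (X : R -> R) (a : midx m k -> R -> R)
    (phi : 'I_m -> R -> R) (x : R) :
  smooth X -> (forall s, (wt s <= k)%N -> smooth (a s)) ->
  (forall j, smooth (phi j)) ->
  quantization beta (Lie_symbol delta X a) phi x -
  Lie_operator lambda mu X (quantization beta a) phi x =
  \sum_(r < k) jet X x r.+2 *
    jet_variation lambda delta r.+2 beta
      (fun s => jet (a s) x) (fun j => jet (phi j) x).
Proof.
move=> sX sa sp.
set al := fun s => jet (a s) x; set ph := fun j => jet (phi j) x.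
have E1 : quantization beta (Lie_symbol delta X a) phi x =
  \sum_(r < k.+2) jet X x r *
    jet_form beta (fun s => jet_lower r (delta - (wt s)%:R) (al s)) ph.
  rewrite -(jet_form_suml _ _ (fun r s => jet_lower r (delta - (wt s)%:R) (al s))).
  rewrite quantizationE; apply: jet_form_eq => // s n sk nk.
  rewrite -[LHS]/(jet (Lie (delta - (wt s)%:R) X (a s)) x n).
  exact: (@jet_Lie _ k.+2 n _ _ _ _ sX (sa _ sk)).
have E2 j : quantization beta a
    (fun l => if l == j then Lie (lambda 0 l) X (phi l) else phi l) x =
  \sum_(r < k.+2) jet X x r *
    jet_form beta al (upd ph (fun l => jet_lower r (lambda 0 l) (ph l)) j).
  rewrite -(jet_form_upd_sum _ _ _ _ (fun r l => jet_lower r (lambda 0 l) (ph l))).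
  rewrite quantizationE; apply: jet_form_eq => // l n nk; rewrite /upd.
  case: eqP => // _.
  rewrite -[LHS]/(jet (Lie (lambda 0 l) X (phi l)) x n).
  exact: (@jet_Lie _ k.+2 n _ _ _ _ sX (sp l)).
have E3 : (quantization beta a phi)^`()%classic x =
          jet_variation lambda delta 0 beta al ph.
  rewrite derive1E; apply: derive_val.
  apply: (is_derive_jet_form (alpha := fun y s => jet (a s) y)
    (dalpha := fun s => jet_lower 0 (delta - (wt s)%:R) (al s))
    (phi := fun y j => jet (phi j) y)
    (dphi := fun l => jet_lower 0 (lambda 0 l) (ph l))) => [s n sk|j n].
    exact: (derive1n_is_derive n x (sa s sk)).
  exact: (derive1n_is_derive n x (sp j)).
have E : quantization beta (Lie_symbol delta X a) phi x +
    \sum_(j < m) quantization beta a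
      (fun l => if l == j then Lie (lambda 0 l) X (phi l) else phi l) x =
    \sum_(r < k.+2) jet X x r * jet_variation lambda delta r beta al ph.
  rewrite E1 (eq_bigr _ (fun j _ => E2 j)) exchange_big -big_split.
  apply: eq_bigr => r _; rewrite /= /jet_variation mulrDr; congr (_ + _).
  by rewrite big_distrr.
rewrite /Lie_operator /Lie opprB addrA E E3 2!big_ord_recl !lift0.
rewrite jet_variation1 quantizationE -/al -/ph.
under eq_bigr do rewrite !lift0.
have -> : jet X x (@ord0 k.+1) = X x by [].
have -> : jet X x 1 = X^`()%classic x by [].
ring.
Qed.

End JetFormAnalysis.

(** * The coordinate at infinity *)

(* With [jet psi y n = (y^2)^(-nu-n) * inversion_jet nu y (jet phi (- 1 / y)) n]
   for [psi] the [nu]-density [phi] read at infinity, this is the recursion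
   obtained by differentiating once more. *)
Fixpoint inversion_jet (R : realType) (nu t : R) (f : nat -> R) (n : nat) : R :=
  if n is n'.+1 then
    inversion_jet nu t (fun l => f l.+1) n' -
    2 * (nu + n'%:R) * t * inversion_jet nu t f n' -
    n'%:R * (2 * nu + n'%:R - 1) * t ^+ 2 * inversion_jet nu t f n'.-1
  else f 0%N.

Lemma inversion_jetZ (R : realType) (nu t c : R) (f : nat -> R) (n : nat) :
  inversion_jet nu t (fun l => c * f l) n = c * inversion_jet nu t f n.
Proof.
elim/ltn_ind: n f => -[//|n] ih f /=.
have /= -> := ih n (ltnSn n) (fun l => f l.+1).
rewrite ih// ih ?ltnS ?leq_pred//; ring.
Qed.

Lemma inversion_jet0 (R : realType) (nu : R) (f : nat -> R) (n : nat) :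
  inversion_jet nu 0 f n = f n.
Proof.
elim: n f => //= n ih f; rewrite (ih (fun l => f l.+1)).
by rewrite expr0n /= !(mulr0, mul0r, subr0).
Qed.

(** Differentiation in [t] lowers the order by one, as for the exponential of a lowering operator.
    The induction is strong because the recursion reaches back two orders. *)
Lemma is_derive_inversion_jet (R : realType) (nu : R) (n : nat)
    (t : R -> R) (dt : R) (f : R -> nat -> R) (df : nat -> R) (x : R) :
  is_derive x 1 t dt ->
  (forall l, is_derive x 1 (fun y => f y l) (df l)) ->
  is_derive x 1 (fun y => inversion_jet nu (t y) (f y) n)
    (inversion_jet nu (t x) df n -
     dt * (n%:R * (2 * nu + n%:R - 1)) * inversion_jet nu (t x) (f x) n.-1).
Proof.
move=> ht; elim/ltn_ind: n f df => -[|n] ih f df hf.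
  by apply: is_derive_congr (hf 0%N) => //=; ring.
have h1 := ih n (ltnSn n) _ _ (fun l => hf l.+1).
have h2 := ih n (ltnSn n) _ _ hf.
have h3 := ih n.-1 (leq_pred n) _ _ hf.
have h4 := is_derive_mull (2 * (nu + n%:R)) (is_derive_mulf ht h2).
have h5 := is_derive_mull (n%:R * (2 * nu + n%:R - 1))
             (is_derive_mulf (is_derive_mulf ht ht) h3).
have := is_derive_addf (is_derive_addf h1 (is_derive_mull (-1) h4))
          (is_derive_mull (-1) h5).
apply: is_derive_congr => [y|]; first by rewrite /=; ring.
rewrite [n.+1.-1]/=.
case: n {ih h1 h2 h3 h4 h5} => [|n]; first by rewrite /=; ring.
rewrite [n.+1.-1]/=.
(* The recursion, solved for the shifted jet, expresses everything about [f] through unshifted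
   jets. *)
have fE := erefl (inversion_jet nu (t x) (f x) n.+1).
rewrite {2}[inversion_jet _ _ _ n.+1]/= in fE.
have -> : inversion_jet nu (t x) (fun l => f x l.+1) n =
  inversion_jet nu (t x) (f x) n.+1 +
  2 * (nu + n%:R) * t x * inversion_jet nu (t x) (f x) n +
  n%:R * (2 * nu + n%:R - 1) * t x ^+ 2 * inversion_jet nu (t x) (f x) n.-1.
  by rewrite fE; ring.
rewrite -[inversion_jet _ _ df n.+2]/(inversion_jet nu (t x) (fun l => df l.+1) n.+1 -
    2 * (nu + n.+1%:R) * t x * inversion_jet nu (t x) df n.+1 -
    n.+1%:R * (2 * nu + n.+1%:R - 1) * t x ^+ 2 * inversion_jet nu (t x) df n).
move: (inversion_jet nu (t x) (f x) n.+1) => A.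
move: (inversion_jet nu (t x) df n.+1) => B.
move: (inversion_jet nu (t x) (fun l => df l.+1) n.+1) => C.
rewrite -!natr1; ring.
Qed.

(** In the derivative of the formula at order [n], the base point [- 1 / y], the power of [y^2] and
    the explicit parameter [y] produce the three terms of the recursion respectively. *)
Lemma jet_at_infinity (R : realType) (nu : R) (phi psi : R -> R) (n : nat)
    (y : R) :
  smooth phi -> smooth psi -> at_infinity nu phi psi -> y != 0 ->
  jet psi y n =
  (y ^+ 2) `^ (- nu - n%:R) * inversion_jet nu y (jet phi (- y^-1)) n.
Proof.
move=> sphi spsi hinf; elim: n y => [|n ih] y y0; first by rewrite subr0; exact: hinf.
have hd := derive1n_is_derive n y spsi.
have hf l : is_derive y 1 (fun z => jet phi (- z^-1) l)
    (y ^- 2 * jet phi (- y^-1) l.+1).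
  have := @is_derive1_comp _ _ (fun z => - z^-1) _ _ _
    (derive1n_is_derive l (- y^-1) sphi) (is_derive_oppV y0).
  by apply: is_derive_congr => //; rewrite mulrC.
have hR := is_derive_mulf (is_derive_sqr_powR (- nu - n%:R) y0)
  (is_derive_inversion_jet nu n (is_derive_id y 1) hf).
(* The formula holds only away from 0, an open condition, so it may still be differentiated at
   [y]. *)
have hE : \near y, jet psi y n =
    (y ^+ 2) `^ (- nu - n%:R) * inversion_jet nu y (jet phi (- y^-1)) n.
  near=> z; apply: ih; near: z.
  exact: (open_neq y0).
have hL := near_eq_is_derive hE hd.
rewrite -[LHS](@derive_val _ _ _ _ _ _ _ hL) (@derive_val _ _ _ _ _ _ _ hR).
have y2n : y ^+ 2 != 0 by rewrite expf_neq0.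
have -> : - nu - n.+1%:R = - nu - n%:R - 1 :> R by rewrite -natr1; ring.
have -> : (y ^+ 2) `^ (- nu - n%:R) = y ^+ 2 * (y ^+ 2) `^ (- nu - n%:R - 1).
  rewrite -{2}[y ^+ 2]powRr1 ?sqr_ge0// -powRD ?y2n ?implybT//.
  by congr (_ `^ _); ring.
rewrite inversion_jetZ /=; field.
Unshelve. all: by end_near. Qed.

(** * Compatibility of the quantization with the inversion [y = - 1 / x] *)

Lemma two_bin2 (R : realType) (n : nat) :
  2 * 'C(n, 2)%:R = n%:R * (n%:R - 1) :> R.
Proof.
case: n => [|n]; first by rewrite mul0r mulr0.
have := mul_bin_diag n.+1 1; rewrite bin1 => /(congr1 (fun x => x%:R : R)).
by rewrite !natrM => <-; rewrite -natr1; ring.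
Qed.

(** The lowering operator of the inversion is twice the one attached to the second derivative of
    [X]; this links the circle to the order 2 equations. *)
Lemma jet_lower2 (R : realType) (nu : R) (f : nat -> R) (n : nat) :
  n%:R * (2 * nu + n%:R - 1) * f n.-1 = 2 * jet_lower 2 nu f n.
Proof.
rewrite /= bin1 subn1 [RHS]mulrA [2 * (_ + _)]mulrDr two_bin2; ring.
Qed.

Section Inversion.
Variables (R : realType) (m k : nat) (beta : midx m k -> midx m k -> R).
Variables (lambda : 'rV[R]_m) (mu delta : R).
Hypothesis hdelta : delta = mu - \sum_(j < m) lambda 0 j.
Hypothesis var2 : forall alpha phi,
  jet_variation lambda delta 2 beta alpha phi = 0.

(* Both sides agree at [t = 0], and the left-hand side is constant in [t] because
   [d/dt inversion_jet nu t f = - 2 jet_lower 2 nu (inversion_jet nu t f)]. *)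
Lemma jet_form_inversion (t : R) (alpha : midx m k -> nat -> R)
    (phi : 'I_m -> nat -> R) :
  jet_form beta (fun s => inversion_jet (delta - (wt s)%:R) t (alpha s))
    (fun j => inversion_jet (lambda 0 j) t (phi j)) =
  jet_form beta alpha phi.
Proof.
pose A t s := inversion_jet (delta - (wt (s : midx m k))%:R) t (alpha s).
pose P t j := inversion_jet (lambda 0 j) t (phi j).
(* The scalar [- 2] is written as a one-term sum to fit [jet_form_suml] and [jet_form_upd_sum]. *)
have dW (nu x : R) (f : nat -> R) n :
    is_derive x 1 (fun t => inversion_jet nu t f n)
      (\sum_(r < 1) (- 2) * jet_lower 2 nu (inversion_jet nu x f) n).
  have := is_derive_inversion_jet nu n (is_derive_id x 1)
    (fun l => is_derive_cst (f l) x 1).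
  apply: is_derive_congr => //; rewrite big_ord1 mulNr -jet_lower2 mul1r.
  have -> : (fun=> 0) = (fun l => 0 * f l) :> (nat -> R).
    by apply/funext => l; rewrite mul0r.
  by rewrite inversion_jetZ mul0r sub0r.
have F0 (x : R) : is_derive x 1 (fun t => jet_form beta (A t) (P t)) 0.
  have hA (s : midx m k) n : (wt s <= k)%N -> is_derive x 1 (fun t => A t s n)
      (\sum_(r < 1) (- 2) * jet_lower 2 (delta - (wt s)%:R) (A x s) n).
    by move=> _; exact: dW.
  have hP j n : is_derive x 1 (fun t => P t j n)
      (\sum_(r < 1) (- 2) * jet_lower 2 (lambda 0 j) (P x j) n) by exact: dW.
  have := is_derive_jet_form beta hA hP.
  apply: is_derive_congr => //.
  rewrite (jet_form_suml _ (fun=> - 2) (fun _ s =>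
    jet_lower 2 (delta - (wt s)%:R) (A x s))).
  have hU j := jet_form_upd_sum beta (fun _ : 'I_1 => - 2) (A x) (P x)
    (fun _ l => jet_lower 2 (lambda 0 l) (P x l)) j.
  rewrite (eq_bigr _ (fun j _ => hU j)) big_ord1.
  under eq_bigr do rewrite big_ord1.
  by rewrite -mulr_sumr -mulrDr [X in _ * X]var2 mulr0.
rewrite -/(A t) -/(P t) (is_derive_0_is_cst t 0 F0).
by apply: jet_form_eq => *; exact: inversion_jet0.
Qed.

(** For each pair [(s, i)] the powers of [y^2] coming from the jets multiply to the exponent [- mu];
    the remaining inversion of jets is removed by [jet_form_inversion]. *)
Lemma quantization_at_infinity (a b : midx m k -> R -> R)
    (phi psi : 'I_m -> R -> R) :
  (forall s, (wt s <= k)%N ->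
     [/\ smooth (a s), smooth (b s) &
         at_infinity (delta - (wt s)%:R) (a s) (b s)]) ->
  (forall j, [/\ smooth (phi j), smooth (psi j) &
                 at_infinity (lambda 0 j) (phi j) (psi j)]) ->
  at_infinity mu (quantization beta a phi) (quantization beta b psi).
Proof.
move=> hab hp y y0; rewrite !quantizationE.
have y2n : y ^+ 2 != 0 by rewrite expf_neq0.
have powD : {morph powR (y ^+ 2) : e e' / e + e' >-> e * e'}.
  by move=> e e'; rewrite powRD// y2n implybT.
rewrite -(jet_form_inversion y (fun s => jet (a s) (- y^-1))
  (fun j => jet (phi j) (- y^-1))) /jet_form big_distrr.
apply: eq_bigr => i ik /=.
have jphi j : jet (psi j) y (i j) = (y ^+ 2) `^ (- lambda 0 j - (i j)%:R) *
    inversion_jet (lambda 0 j) y (jet (phi j) (- y^-1)) (i j).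
  by have [? ? ?] := hp j; exact: jet_at_infinity.
under [in LHS]eq_bigr do rewrite jphi.
rewrite big_split /= -(big_morph _ powD (powRr0 _)) !mulrA; congr (_ * _).
rewrite mulr_suml mulr_sumr; apply: eq_bigr => s /andP[is_ sk].
have [sa sb hinf] := hab s sk.
rewrite (jet_at_infinity _ sa sb hinf y0).
have -> : - mu = - (delta - (wt s)%:R) - (wt s - wt i)%:R +
    \sum_(j < m) (- lambda 0 j - (i j)%:R).
  by rewrite big_split /= !sumrN -natr_sum -/(wt i) hdelta natrB//; ring.
by rewrite [X in _ = X * _]powD; ring.
Qed.

(** On the circle, the operator read at infinity is the quantization of the symbol read at
    infinity. *)
Lemma quantization_differential (M : curve) (a : midx m k -> R -> R) :
  symbol M delta a ->
  differential_operator M k lambda mu (quantization beta a).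
Proof.
have coef_smooth (b : midx m k -> R -> R) (i : midx m k) :
    (forall s, (wt s <= k)%N -> smooth (b s)) ->
    smooth (fun x => \sum_(s : midx m k | (wt i <= wt s <= k)%N)
      beta s i * (b s)^`(wt s - wt i)%classic x).
  move=> sb; apply: (@tower_smooth _ (fun n x =>
    \sum_(s : midx m k | (wt i <= wt s <= k)%N)
      beta s i * (b s)^`(n + (wt s - wt i))%classic x)) => n x.
  apply: is_derive_bigsum => s /andP[_ sk]; apply: is_derive_mull.
  exact: (derive1n_is_derive (n + (wt s - wt i)) x (sb s sk)).
move=> ha; split=> [|MC].
  exists (fun i x => \sum_(s : midx m k | (wt i <= wt s <= k)%N)
    beta s i * (a s)^`(wt s - wt i)%classic x); split=> // i ik.
  by apply: coef_smooth => s sk; case: (ha s sk).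
have /choice[b hb] : forall s : midx m k, exists b : R -> R, (wt s <= k)%N ->
    smooth b /\ at_infinity (delta - (wt s)%:R) (a s) b.
  move=> s; have [sk|_] := leqP (wt s) k; last by exists 0.
  by have [_ /(_ MC)[b hb]] := ha s sk; exists b.
exists (fun i x => \sum_(s : midx m k | (wt i <= wt s <= k)%N)
  beta s i * (b s)^`(wt s - wt i)%classic x); split=> [i ik|phi psi hp].
  by apply: coef_smooth => s sk; case: (hb s sk).
apply: quantization_at_infinity => [s sk|j].
  by have [? ?] := hb s sk; split=> //; case: (ha s sk).
by have [? [? ?]] := hp j.
Qed.

End Inversion.

(** * Equivariance as linear equations *)

Section Equivariance.
Variables (R : realType) (M : curve) (m k : nat) (lambda : 'rV[R]_m).
Variables (mu delta : R) (beta : midx m k -> midx m k -> R).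
Hypothesis hdelta : delta = mu - \sum_(j < m) lambda 0 j.

Lemma jet_variation_eq0 (r : nat) :
  (forall s i : midx m k, (wt i + r <= wt s)%N -> (wt s <= k)%N ->
     defect lambda delta r beta s i = 0) ->
  forall alpha phi, jet_variation lambda delta r.+1 beta alpha phi = 0.
Proof.
move=> h alpha phi; rewrite jet_variationE big1// => i ik.
by rewrite big1 ?mul0r// => s /andP[is_ sk]; rewrite h// mul0r.
Qed.

Lemma jet_variation_delta (r : nat) (s i : midx m k) alpha phi :
  (wt i + r <= wt s)%N -> (wt s <= k)%N ->
  (forall t n, (n <= k)%N ->
     alpha t n = ((t == s) && (n == wt s - wt i - r)%N)%:R) ->
  (forall j n, (n <= k)%N -> phi j n = (n == i j)%:R) ->
  jet_variation lambda delta r.+1 beta alpha phi =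
  defect lambda delta r beta s i.
Proof.
move=> irs sk ha hp; rewrite jet_variationE.
have ik : (wt i <= k)%N by rewrite (leq_trans _ (leq_trans irs sk))// leq_addr.
have subk t (n p : nat) : (wt (t : midx m k) <= k)%N -> (wt t - n - p <= k)%N.
  by move=> tk; rewrite !(leq_trans (leq_subr _ _)).
rewrite (bigD1 i)//= [X in _ + X]big1 ?addr0; last first.
  move=> i' /andP[_ /eqP ii']; have [j jne] : exists j, i' j != i j.
    apply/existsP; rewrite -[X in is_true X]negbK negb_exists.
    apply/forallP => e; apply: ii'; apply/ffunP => j.
    by apply/eqP; rewrite -[_ == _]negbK.
  by rewrite (bigD1 j)//= hp -1?ltnS// val_eqE (negPf jne) mul0r mulr0.
rewrite [X in _ * X]big1 ?mulr1; last by move=> j _; rewrite hp -1?ltnS// eqxx.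
rewrite (bigD1 s)/= ?irs//= ha ?subk// !eqxx mulr1 big1 ?addr0//.
by move=> t /andP[/andP[_ tk] /negPf ts]; rewrite ha ?subk// ts mulr0.
Qed.

Lemma Vect_equivariantE :
  Vect_equivariant M lambda mu delta (quantization beta) <->
  forall r (s i : midx m k), (wt i + r.+1 <= wt s)%N -> (wt s <= k)%N ->
    defect lambda delta r.+1 beta s i = 0.
Proof.
split=> [[_ heq] r s i irs sk|h]; last first.
  have var0 r := jet_variation_eq0 (h r).
  split=> [a ha|X a phi [sX _] ha hp].
    (* The order 2 equations alone give regularity at infinity. *)
    exact: (quantization_differential hdelta (var0 0%N)).
  apply/funext => x; apply/esym/eqP; rewrite -subr_eq0; apply/eqP.
  have sa t : (wt t <= k)%N -> smooth (a t) by move=> tk; case: (ha t tk).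
  have sp j : smooth (phi j) by case: (hp j).
  rewrite -[LHS](esym (Lie_quantization beta hdelta x sX sa sp)).
  by rewrite big1// => r _; rewrite var0 mulr0.
have rk : (r < k)%N.
  by rewrite (leq_trans _ (leq_trans irs sk))// leq_addl.
(* Test data whose jets at 0 are delta sequences isolate a single [defect]; [X] needs order [k + 1],
   the highest that occurs. *)
have [X [dX jX]] := density_jet M (-1) k.+1 (fun n => (n == r.+2)%:R : R).
have [a ha] := choice (fun t : midx m k => density_jet M (delta - (wt t)%:R) k
  (fun n => ((t == s) && (n == wt s - wt i - r.+1)%N)%:R)).
have [phi hp] := choice (fun j : 'I_m => density_jet M (lambda 0 j) k
  (fun n => (n == i j)%:R)).
have sa t : (wt t <= k)%N -> smooth (a t) by move=> _; case: (ha t) => -[].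
have sp j : smooth (phi j) by case: (hp j) => -[].
have := Lie_quantization beta hdelta 0 dX.1 sa sp.
rewrite heq//; last 2 first.
  by move=> t _; case: (ha t).
  by move=> j; case: (hp j).
have {}jX (n : 'I_k) : jet X 0 n.+2 = (n == r :> nat)%:R.
  by rewrite [LHS]jX ?ltnS// !eqSS.
rewrite subrr (bigD1 (Ordinal rk))// big1 ?addr0 => [|r' r'r]; last first.
  by rewrite jX -[_ == _]/(r' == Ordinal rk) (negPf r'r) mul0r.
rewrite jX eqxx mul1r => /esym E.
rewrite -(jet_variation_delta irs sk (fun t => (ha t).2) (fun j => (hp j).2)).
by rewrite -[RHS]E; apply/esym; exact: addr0.
Qed.

End Equivariance.

(** * The equations in weights 2 and 3 *)

Section Arithmetic.
Variables (R : realType) (m k : nat) (lambda : 'rV[R]_m) (delta : R).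
Variable beta : midx m k -> midx m k -> R.

Lemma two_defect1 (s i : midx m k) : (wt i < wt s)%N ->
  2 * defect lambda delta 1 beta s i =
  (2 * delta - 1 - (wt s)%:R - (wt i)%:R) * ((wt s)%:R - (wt i)%:R) * beta s i
  + \sum_(j < m) ((i j)%:R + 1) * (2 * lambda 0 j + (i j)%:R) * beta s (add1 i j).
Proof.
move=> is_; rewrite /defect mulrDr mulrA mulrDr two_bin2 bin1 natrB ?(ltnW is_)//.
congr (_ + _); first by congr (_ * _); ring.
rewrite mulr_sumr; apply: eq_bigr => j _.
rewrite mulrA mulrDr two_bin2 bin1 addn1 -natr1 add1_shift; congr (_ * _); ring.
Qed.

Lemma sl2_recursionE :
  sl2_recursion lambda delta beta <->
  forall s i : midx m k, (wt s <= k)%N -> (wt i < wt s)%N ->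
    defect lambda delta 1 beta s i = 0.
Proof.
split=> h s i sk is_; last by rewrite -two_defect1// h// mulr0.
by apply: (@mulfI _ 2); rewrite ?pnatr_eq0// mulr0 two_defect1// h.
Qed.

Definition midx0 : midx m k := [ffun => ord0].

Lemma wt_midx0 : wt midx0 = 0%N.
Proof. by rewrite /wt big1// => j _; rewrite ffunE. Qed.

Lemma wt_eq0 (i : midx m k) : wt i = 0%N -> i = midx0.
Proof.
move=> i0; apply/ffunP => j; apply/val_inj; rewrite ffunE /=.
by apply/eqP; rewrite -leqn0 -i0 leq_midx_wt.
Qed.

Lemma shift_shift_midx (p q : nat) (j : 'I_m) (i : midx m k) :
  (wt i + p + q <= k)%N ->
  shift_midx q j (shift_midx p j i) = shift_midx (p + q) j i.
Proof.
move=> ipq; have ip : (wt i + p <= k)%N by rewrite (leq_trans _ ipq)// leq_addr.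
apply/ffunP => l; apply/val_inj; rewrite /= !shift_midxE ?wt_shift_midx//.
  by rewrite mulnDr addnA.
by rewrite addnA.
Qed.

(* The coefficient of [beta s (1_j + 1_l)] in the obstruction in weight 2. *)
Definition pair_coef (j l : 'I_m) : R :=
  if l == j then 2 * lambda 0 j * (lambda 0 j + delta - 1)
  else lambda 0 j * lambda 0 l.

(** The factor [2 * delta - 3] avoids division. The recursion at 0 turns it times [beta s 0] into a
    combination of the [beta s 1_j], and the factor [delta - 2] already present in the defect is the
    one that the recursion at [1_j] requires. *)
Lemma defect2_weight2 (s : midx m k) : (wt s <= k)%N -> wt s = 2%N ->
  (forall i : midx m k, (wt i < wt s)%N -> defect lambda delta 1 beta s i = 0) ->
  (2 * delta - 3) * defect lambda delta 2 beta s midx0 =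
  \sum_(j < m) \sum_(l < m)
    pair_coef j l * beta s (shift_midx 1 l (shift_midx 1 j midx0)).
Proof.
move=> sk s2 hd; rewrite s2 in sk hd.
have w1 j : wt (shift_midx 1 j midx0) = 1%N.
  by rewrite wt_shift_midx wt_midx0// ltnW.
have h0 := hd midx0; rewrite wt_midx0 in h0; have {}h0 := h0 isT.
have h1 j : defect lambda delta 1 beta s (shift_midx 1 j midx0) = 0.
  by apply: hd; rewrite w1.
rewrite /defect wt_midx0 s2 subn0 in h0.
rewrite /defect wt_midx0 s2 subn0.
have -> : 'C(2, 3) = 0%N by []. have -> : 'C(2, 2) = 1%N by [].
have h0' : (2 * delta - 3) * beta s midx0 =
    - \sum_(j < m) lambda 0 j * beta s (shift_midx 1 j midx0).
  apply/eqP; rewrite -addr_eq0 -[X in _ == X]h0 binn bin1; apply/eqP.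
  congr (_ * _ + _); first by ring.
  apply: eq_bigr => j _; rewrite ffunE.
  by rewrite bin_small// add0r binn mulr1.
have h1' j : (delta - 2) * beta s (shift_midx 1 j midx0) =
    - \sum_(l < m) ((l == j)%:R * (1 + lambda 0 l) + lambda 0 l) *
        beta s (shift_midx 1 l (shift_midx 1 j midx0)).
  apply/eqP; rewrite -addr_eq0 -[X in _ == X](h1 j) /defect w1 s2; apply/eqP.
  congr (_ * _ + _); first by rewrite binn bin_small// mulr1 add0r.
  apply: eq_bigr => l _; congr (_ * _).
  rewrite shift_midxE ?wt_midx0 1?ltnW// ffunE muln1 add0n.
  case: (l == j).
    by rewrite -[(true + 1)%N]/2%N binn bin1 mul1r mulr_natr mulr2n addrA.
  by rewrite -[(false + 1)%N]/1%N bin_small// bin1 mul0r mulr1.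
have -> : \sum_(j < m) ('C(midx0 j + 2, 3)%:R + lambda 0 j * 'C(midx0 j + 2, 2)%:R) *
      beta s (shift_midx 2 j midx0) =
   \sum_(j < m) lambda 0 j * beta s (shift_midx 1 j (shift_midx 1 j midx0)).
  apply: eq_bigr => j _; rewrite shift_shift_midx ?wt_midx0// ffunE.
  by rewrite bin_small// add0r binn mulr1.
rewrite mulrDr mulr_sumr.
have -> : (2 * delta - 3) * ((0%:R + (delta - 2) * 1%:R) * beta s midx0) =
    (delta - 2) * ((2 * delta - 3) * beta s midx0) by ring.
rewrite h0' mulrN mulr_sumr -sumrN -big_split; apply: eq_bigr => j _ /=.
rewrite mulrCA -mulrN h1' opprK mulr_sumr.
rewrite (bigD1 j)// [RHS](bigD1 j)//= /pair_coef eqxx addrAC.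
congr (_ + _); first by rewrite mul1r; ring.
by apply: eq_bigr => l /negPf lj; rewrite lj mul0r add0r mulrA.
Qed.

Lemma shift_pair_eq (j l j' l' : 'I_m) : (2 <= k)%N ->
  shift_midx 1 l' (shift_midx 1 j' midx0) = shift_midx 1 l (shift_midx 1 j midx0) ->
  (j' = j /\ l' = l) \/ (j' = l /\ l' = j).
Proof.
move=> k2 /ffunP e.
have {}e x : ((x == j') + (x == l') = (x == j) + (x == l))%N.
  have := congr1 (@nat_of_ord _) (e x).
  have k1 := ltnW k2.
  by rewrite !shift_midxE ?wt_shift_midx ?wt_midx0// ffunE !muln1.
have [jj|jj] := eqVneq j' j.
  left; split=> //; have := e l'; rewrite -jj (eqxx l') => /eqP.
  by rewrite eqn_add2l; have [->|] := eqVneq l' l.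
have [jl|jl] := eqVneq j' l; last first.
  by have := e j'; rewrite eqxx (negPf jj) (negPf jl).
right; split=> //; have /eqP := e l'; rewrite -jl (eqxx l') addnC.
by rewrite eqn_add2r; have [->|] := eqVneq l' j.
Qed.

Lemma pair_coefC (j l : 'I_m) : pair_coef j l = pair_coef l j.
Proof.
rewrite /pair_coef; have [->//|lj] := eqVneq l j.
exact: mulrC.
Qed.

(** A relation valid for all [s] of weight [p] says that the column [v] lies in the kernel of the
    invertible block [beta_block beta p]. *)
Lemma principal_symbol_inj (p : nat) (v : midx m k -> R) :
  principal_symbol beta -> (p <= k)%N ->
  (forall s : midx m k, wt s = p ->
     \sum_(i : midx m k | wt i == p) v i * beta s i = 0) ->
  forall i : midx m k, wt i = p -> v i = 0.
Proof.
move=> hb pk hv i ip.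
pose V : 'cV[R]_#|midx_wt m k p| := \col_x v (enum_val x).
have : beta_block beta p *m V = 0.
  apply/matrixP => x y; rewrite !mxE -[RHS](hv (enum_val x)).
    rewrite [RHS](eq_bigl (mem (midx_wt m k p))) => [|z]; last by rewrite /= inE.
    by rewrite [RHS]big_enum_val; apply: eq_bigr => z _; rewrite !mxE mulrC.
  by have := enum_valP x; rewrite inE => /eqP.
move/(congr1 (mulmx (invmx (beta_block beta p)))).
rewrite mulmx0 mulKmx ?hb// => V0.
have iin : i \in midx_wt m k p by rewrite inE ip.
have := congr1 (fun A : 'cV_ _ => A (enum_rank_in iin i) 0) V0.
by rewrite !mxE enum_rankK_in.
Qed.

(** The ordered pairs [(j, l)] and [(l, j)] give the same multi-index and the same [pair_coef]. The
    total coefficient is thus [pair_coef j l] times a positive count, which is invertible in [R]. *)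
Lemma pair_coef_eq0 : (2 <= k)%N -> principal_symbol beta ->
  (forall r (s i : midx m k), (wt i + r.+1 <= wt s)%N -> (wt s <= k)%N ->
     defect lambda delta r.+1 beta s i = 0) ->
  forall j l, pair_coef j l = 0.
Proof.
move=> k2 hb hd j l.
pose e (j l : 'I_m) : midx m k := shift_midx 1 l (shift_midx 1 j midx0).
have we j' l' : wt (e j' l') = 2%N.
  by rewrite !wt_shift_midx ?wt_midx0//; exact: ltnW.
pose v (i : midx m k) :=
  \sum_(j' < m) \sum_(l' < m) pair_coef j' l' * (e j' l' == i)%:R.
have v0 : v (e j l) = 0.
  apply: (principal_symbol_inj hb k2 _ (we j l)) => s s2.
  have sk : (wt s <= k)%N by rewrite s2.
  have hd1 (i : midx m k) : (wt i < wt s)%N -> defect lambda delta 1 beta s i = 0.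
    by move=> is_; apply: (hd 0%N) => //; rewrite addn1.
  have := defect2_weight2 sk s2 hd1.
  rewrite (hd 1%N) ?wt_midx0 ?s2// mulr0 => E.
  rewrite [RHS]E /v.
  under eq_bigr do rewrite mulr_suml; rewrite exchange_big; apply: eq_bigr => j' _.
  under eq_bigr do rewrite mulr_suml; rewrite exchange_big; apply: eq_bigr => l' _ /=.
  rewrite (bigD1 (e j' l')) ?we//= eqxx mulr1 big1 ?addr0// => i /andP[_ ie].
  by rewrite eq_sym (negPf ie) mulr0 mul0r.
have vE : v (e j l) =
    pair_coef j l * (\sum_(j' < m) \sum_(l' < m) (e j' l' == e j l))%:R.
  rewrite natr_sum mulr_sumr; apply: eq_bigr => j' _.
  rewrite natr_sum mulr_sumr; apply: eq_bigr => l' _.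
  have [/(shift_pair_eq k2)|] := eqVneq (e j' l') (e j l); last by rewrite !mulr0.
  by case=> -[-> ->] //; rewrite pair_coefC.
move: v0; rewrite vE => /eqP; rewrite mulf_eq0 pnatr_eq0 => /orP[/eqP //|].
by rewrite (bigD1 j)//= (bigD1 l)//= eqxx.
Qed.

(** When [lambda] is supported at [l], raising a zero entry in another direction has coefficient 0,
    so the equations close on the multiples of [1_l]. *)
Lemma defect_axis (r q : nat) (s : midx m k) (l : 'I_m) : (0 < r)%N ->
  (forall j, j != l -> lambda 0 j = 0) -> (q + r <= k)%N ->
  defect lambda delta r beta s (shift_midx q l midx0) =
  ('C(wt s - q, r.+1)%:R + (delta - (wt s)%:R) * 'C(wt s - q, r)%:R) *
    beta s (shift_midx q l midx0) +
  ('C(q + r, r.+1)%:R + lambda 0 l * 'C(q + r, r)%:R) *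
    beta s (shift_midx (q + r) l midx0).
Proof.
move=> r0 hl qr; have qk : (q <= k)%N by rewrite (leq_trans _ qr)// leq_addr.
rewrite /defect wt_shift_midx wt_midx0//; congr (_ + _).
rewrite (bigD1 l)//= big1 ?addr0.
  by rewrite shift_midxE ?wt_midx0// ffunE eqxx mul1n shift_shift_midx ?wt_midx0.
move=> j jl; rewrite shift_midxE ?wt_midx0// ffunE (negPf jl) hl//.
by rewrite bin_small// mul0r addr0 mul0r.
Qed.

Lemma weight3_eq0 (s : midx m k) (l : 'I_m) :
  (forall j, j != l -> lambda 0 j = 0) -> pair_coef l l = 0 -> delta != 1 ->
  (wt s <= k)%N -> wt s = 3%N ->
  (forall r (i : midx m k), (wt i + r.+1 <= wt s)%N ->
     defect lambda delta r.+1 beta s i = 0) ->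
  beta s (shift_midx 3 l midx0) = 0.
Proof.
move=> hl; rewrite /pair_coef eqxx => hll d1 sk s3 hd; rewrite s3 in sk.
have hd' r q : (q + r.+1 <= 3)%N ->
    defect lambda delta r.+1 beta s (shift_midx q l midx0) = 0.
  move=> qr; apply: hd; rewrite wt_shift_midx wt_midx0// ?s3//.
  by rewrite (leq_trans _ sk)// (leq_trans _ qr)// leq_addr.
have := hd' 0%N 2%N isT; rewrite defect_axis// s3 => h2.
have := hd' 0%N 1%N isT; rewrite defect_axis// ?s3 1?ltnW// => h1.
have := hd' 1%N 1%N isT; rewrite defect_axis// s3 => h12.
move: h1 h2 h12; rewrite !addn1 !addn2.
have -> : 'C(3 - 1, 2) = 1%N by []. have -> : 'C(3 - 1, 1) = 2%N by [].
have -> : 'C(3 - 1, 3) = 0%N by []. have -> : 'C(3 - 2, 2) = 0%N by [].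
have -> : 'C(3 - 2, 1) = 1%N by [].
have -> : 'C(3, 2) = 3%N by []. have -> : 'C(3, 1) = 3%N by [].
have -> : 'C(3, 3) = 1%N by [].
move: (beta s (shift_midx 1 l midx0)) (beta s (shift_midx 2 l midx0)) => b1 b2.
move: (beta s _) => b3 h1 h2 h12.
have : 2 * (delta - 1) * b3 = 0.
  (* The multipliers eliminate [b1] and [b2]. The coefficient of [b3] is then [2 (delta - 1) + 6
     lambda_l (lambda_l + delta - 1)], whose second term is three times [pair_coef l l]. *)
  transitivity ((2 * delta - 5) * 0 + (1 + 2 * lambda 0 l) * 0 -
    (delta - 3) * 0 - 3 * 0 * b3); last by ring.
  by rewrite -{1}h12 -{1}h2 -{1}h1 -hll; ring.
by move/eqP; rewrite !mulf_eq0 pnatr_eq0 subr_eq0 (negPf d1) => /eqP.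
Qed.

End Arithmetic.

(** * Solving the recursion *)

(** The argument [n] stands for [wt s - wt i] and makes the recursion structural. Its base case
    takes identity matrices as principal symbol. *)
Fixpoint sl2_solution (R : realType) (m k : nat) (lambda : 'rV[R]_m)
    (delta : R) (n : nat) (s i : midx m k) : R :=
  if n is n'.+1 then
    - (\sum_(j < m) ((i j)%:R + 1) * (2 * lambda 0 j + (i j)%:R) *
         sl2_solution lambda delta n' s (add1 i j)) /
    ((2 * delta - 1 - (wt s)%:R - (wt i)%:R) * ((wt s)%:R - (wt i)%:R))
  else (s == i)%:R.

Lemma sl2_solution_exists (R : realType) (m k : nat) (lambda : 'rV[R]_m)
    (delta : R) :
  (forall l : nat, (2 <= l <= 2 * k)%N -> delta != l%:R / 2) ->
  exists2 beta : midx m k -> midx m k -> R,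
    principal_symbol beta & sl2_recursion lambda delta beta.
Proof.
move=> hcrit.
exists (fun s i => sl2_solution lambda delta (wt s - wt i) s i).
  move=> p _; rewrite (_ : beta_block _ p = 1%:M) ?unitmx1//.
  apply/matrixP => s i; rewrite !mxE.
  have := enum_valP s; have := enum_valP i; rewrite !inE => /eqP -> /eqP ->.
  by rewrite subnn /= (inj_eq enum_val_inj).
move=> s i sk is_.
have -> : (wt s - wt i = (wt s - (wt i).+1).+1)%N by rewrite -subSn.
have step j : (wt s - wt (add1 i j) = wt s - (wt i).+1)%N.
  by rewrite add1_shift wt_shift_midx ?addn1// (leq_trans is_).
under eq_bigr do rewrite step.
rewrite /= [X in X + _]mulrC divfK ?addNr// mulf_neq0//; last first.
  by rewrite subr_eq0 eqr_nat gtn_eqF.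
(* The denominator could vanish only for [2 delta = |s| + |i| + 1], a critical value since
   [|i| < |s| <= k]. *)
have hl : (2 <= wt s + wt i + 1 <= 2 * k)%N by lia.
apply: contra_neq (hcrit _ hl) => h.
rewrite !natrD; apply: (@mulfI _ 2); rewrite ?pnatr_eq0// mulrCA mulfV ?pnatr_eq0//.
by apply/eqP; rewrite -subr_eq0 -h; apply/eqP; ring.
Qed.

Theorem theorem8p1 (R : realType) (M : curve) (m k : nat)
    (lambda : 'rV[R]_m) (mu delta : R)
    (hm : (1 <= m)%N) (hk : (1 <= k)%N)
    (hdelta : delta = mu - \sum_(j < m) lambda 0 j)
    (hcrit : forall l : nat, (2 <= l <= 2 * k)%N -> delta != l%:R / 2) :
  (exists beta : midx m k -> midx m k -> R,
     [/\ principal_symbol beta,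
         sl2_recursion lambda delta beta &
         Vect_equivariant M lambda mu delta (quantization beta)])
  <->
  (k = 1%N \/
   (k = 2%N /\
    (lambda = 0 \/ exists j : 'I_m, lambda = (1 - delta) *: delta_mx 0 j))).
Proof.
have d1 : delta != 1.
  have := hcrit 2%N; rewrite divff ?pnatr_eq0//; apply.
  by lia.
split=> [[beta [hb _ /(Vect_equivariantE _ _ hdelta) hd]]|hcases].
  have [k2|k2] := leqP 2 k; last by left; apply/eqP; rewrite eqn_leq hk -ltnS k2.
  right; have c0 := pair_coef_eq0 k2 hb hd.
  have diag j : lambda 0 j != 0 -> lambda 0 j = 1 - delta.
    move=> lj; have := c0 j j; rewrite /pair_coef eqxx => /eqP.
    rewrite !mulf_eq0 pnatr_eq0 (negPf lj) /= => /eqP h.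
    by apply/eqP; rewrite -subr_eq0 -h; apply/eqP; ring.
  have offdiag j l : lambda 0 j != 0 -> l != j -> lambda 0 l = 0.
    move=> lj ljne; have := c0 j l; rewrite /pair_coef (negPf ljne) => /eqP.
    by rewrite mulf_eq0 (negPf lj) => /eqP.
  (* At most one entry of [lambda] is non-zero; if all vanish, any position serves as [l], and [hm]
     provides one. *)
  have [l hl] : exists l, forall j, j != l -> lambda 0 j = 0.
    have [/existsP[l ll]|/existsPn h] := boolP [exists l, lambda 0 l != 0].
      by exists l => j; exact: offdiag.
    by exists (Ordinal hm) => j _; apply/eqP; rewrite -[_ == _]negbK h.
  split.
    (* For [k >= 3] the column of [3 1_l] in the block of weight 3 would be zero. *)
    apply/eqP; rewrite eqn_leq k2 andbT leqNgt; apply/negP => k3.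
    have w3 : wt (shift_midx 3 l (midx0 m k)) = 3%N.
      by rewrite wt_shift_midx wt_midx0.
    suff hv (s : midx m k) : wt s = 3%N -> \sum_(i : midx m k | wt i == 3%N)
        (i == shift_midx 3 l (midx0 m k))%:R * beta s i = 0.
      have := principal_symbol_inj hb k3 hv w3.
      by rewrite eqxx => /eqP; rewrite oner_eq0.
    move=> s3.
    rewrite (bigD1 (shift_midx 3 l (midx0 m k))) ?w3//= eqxx mul1r big1 ?addr0.
      apply: (weight3_eq0 hl (c0 l l) d1) => // [|r i ir]; first by rewrite s3.
      by apply: hd => //; rewrite s3.
    by move=> i /andP[_ /negPf ->]; rewrite mul0r.
  have [l0|lne] := eqVneq (lambda 0 l) 0.
    left; apply/rowP => j; rewrite mxE.
    by have [->//|] := eqVneq j l; exact: hl.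
  right; exists l; apply/rowP => j; rewrite !mxE eqxx.
  have [->|jl] := eqVneq j l; first by rewrite mulr1 diag.
  by rewrite mulr0 hl.
have [beta hb hrec] := sl2_solution_exists lambda hcrit.
exists beta; split=> //; apply/(Vect_equivariantE _ _ hdelta) => r s i irs sk.
have hrec1 := (sl2_recursionE lambda delta beta).1 hrec.
(* Index 0 is the [sl(2)] recursion itself; beyond it, [k <= 2] leaves only the equation with
   [|s| = 2] and [i = 0]. *)
case: r irs => [|r] irs; first by apply: hrec1; rewrite // -addn1.
case: hcases => [k1|[k2 hlam]]; first by lia.
have [r0 i0 s2] : [/\ r = 0%N, wt i = 0%N & wt s = 2%N] by split; lia.
rewrite r0 (wt_eq0 i0).
(* The critical value [3 / 2] is excluded as soon as [k = 2], so the factor in [defect2_weight2] can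
   be cancelled. *)
have nz : 2 * delta - 3 != 0.
  apply: contra_neq (hcrit 3%N _) => [h|]; last by rewrite k2.
  by apply: (@mulfI _ 2); rewrite ?pnatr_eq0// mulrCA mulfV ?pnatr_eq0// mulr1;
    apply/eqP; rewrite -subr_eq0 h.
apply: (mulfI nz); rewrite mulr0 defect2_weight2// => [|i' is_]; last exact: hrec1.
rewrite big1// => j _; rewrite big1// => l _.
suff -> : pair_coef lambda delta j l = 0 by rewrite mul0r.
rewrite /pair_coef; case: hlam => [->|[q ->]].
  by rewrite !mxE !(mulr0, mul0r) if_same.
rewrite !mxE eqxx /=; case: eqVneq => [_|lj].
  by case: (j == q); rewrite ?mulr0 ?mul0r// mulr1; ring.
have [jq|] := eqVneq j q; last by rewrite mulr0 mul0r.
by rewrite -jq (negPf lj) !mulr0.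
Qed.
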